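(* Let $\xi=\{\xi_m\}_{m\ge0}$ be a subnormal sequence and let $\{a_m\}_{m\ge 0}$ be complex numbers. Suppose there exist an increasing sequence $n_0<n_1<n_2<\cdots$ of positive integers and constants $C_1,C_2>0$ such that for all $k$ we have $g(n_{k+1})\le C_1g(n_k)$ and $$\sum_{j=1}^k\sqrt{\Big(\sum_{m=n_{j-1}+1}^{n_j}|a_m|^2\Big)\log n_j}\le C_2\,g(n_k).$$ Then $u(z,\xi)=\sum_{m=0}^\infty a_m\xi_mz^m\in A_v^\infty$ almost surely.
   Context: $\mathbf D$ is the open unit disk in the complex plane. The weight $v$ is a positive increasing continuous function on $[0,1)$ with $v(0)=1$, $\lim_{r\to 1}v(r)=+\infty$, satisfying $v(1-t)\le D\,v(1-2t)$ for $0<t\le 1/2$ and some constant $D$. Put $g(x)=v(1-1/x)$ for $x\ge 1$, so $g(2x)\le D g(x)$. $A_v^\infty$ is the space of analytic functions $u$ on $\mathbf D$ with $|u(z)|\le Kv(|z|)$ on $\mathbf D$ for some $K$. A real random variable $\omega$ is subnormal if $\mathcal E(e^{\lambda\omega})\le e^{\lambda^2/2}$ for all $\lambda\in\mathbf R$ ($\mathcal E$ denotes expectation). A subnormal sequence is a sequence of independent subnormal random variables. *)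

(* Defs.v *)
From mathcomp Require Export all_boot all_order all_algebra.
From mathcomp Require Export all_classical all_reals all_analysis.
From mathcomp Require Export complex.

Set Implicit Arguments.
Unset Strict Implicit.
Unset Printing Implicit Defensive.

Export Order.TTheory GRing.Theory Num.Theory.
Export numFieldNormedType.Exports.

Local Open Scope classical_set_scope.
Local Open Scope ring_scope.
Local Open Scope complex_scope.

(* The real-valued modulus; the norm `|z| of mathcomp lives in R[i] itself
   and is (normc z)%:C. *)
Notation normc := ComplexField.Normc.normc.

(* "Increasing" is taken in the wide sense. v is unconstrained outside
   of [0, 1[. *)
Record weight (R : realType) (v : R -> R) : Prop := Weight {
  weight_gt0 : forall r, 0 <= r < 1 -> 0 < v r;
  weight_incr : forall r s, 0 <= r -> r <= s -> s < 1 -> v r <= v s;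
  weight_cont : {within `[0, 1[, continuous v};
  weight0 : v 0 = 1;
  weight_lim : v r @[r --> 1^'-] --> +oo;
  weight_doubling : exists D : R, forall t, 0 < t <= 2^-1 ->
    v (1 - t) <= D * v (1 - 2 * t) }.

Definition weight_g (R : realType) (v : R -> R) (x : R) : R := v (1 - x^-1).

Definition disk (R : realType) : set R[i] := [set z | normc z < 1].

(* The alias R[i]^o carries the topology and the normed R[i]-module structure,
   so that derivability along 1 is complex differentiability. *)
Definition analytic_on (R : realType) (A : set R[i]) (f : R[i] -> R[i]) : Prop :=
  forall z : R[i], A z -> derivable (f : R[i]^o -> R[i]^o) z 1.

Definition growth_space (R : realType) (v : R -> R) : set (R[i] -> R[i]) :=
  [set u | analytic_on (@disk R) u /\
     exists K : R, forall z, disk z -> normc (u z) <= K * v (normc z)].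

Definition power_series (R : realType) (c : nat -> R[i]) (z : R[i]) (N : nat) :
  R[i]^o := \sum_(0 <= m < N) c m * z ^+ m.

(* limn is total: this is the sum of the series only where it converges. *)
Definition power_series_sum (R : realType) (c : nat -> R[i]) (z : R[i]) : R[i] :=
  limn (power_series c z).

Section Random.
Context (d : measure_display) (T : measurableType d) (R : realType).
Variable P : probability T R.

Definition subnormal (X : {RV P >-> R}) : Prop :=
  forall lambda : R, ('M_P X lambda <= (expR (lambda ^+ 2 / 2))%:E)%E.

Definition independent_RVs (X : nat -> {RV P >-> R}) : Prop :=
  forall (s : seq nat) (B : nat -> set R), uniq s ->
    (forall i, measurable (B i)) ->
    P (\bigcap_(i in [set` s]) (X i @^-1` B i))
      = (\prod_(i <- s) P (X i @^-1` B i))%E.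

Definition subnormal_sequence (X : nat -> {RV P >-> R}) : Prop :=
  independent_RVs X /\ forall m, subnormal (X m).

End Random.

(* Main.v *)
Require Import Defs.
From mathcomp Require Import measurable_realfun ring lra.

(* Cut the series into the blocks n_{j-1} < m <= n_j and let A_j be the j-th term
   of the sum in the hypothesis.  On a net of the closed unit disk with
   polynomially many points in n_j, the value of the block polynomial (divided by
   z^(n_{j-1}+1)) is a subnormal variable up to scaling, so a union bound costs
   only a factor sqrt(log n_j); since |xi_m| = O(m) almost surely, the net is
   fine enough for the bound O(A_j) to hold on the whole disk.  Hence
   |u(z)| = O(1 + sum_j |z|^(n_{j-1}) A_j), and summation by parts together with
   the polynomial growth g(x) = O((1 + x(1-r))^p v(r)) bounds this by O(v(|z|)). *)

Import Order.TTheory GRing.Theory Num.Theory.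

Set Implicit Arguments.
Unset Strict Implicit.
Unset Printing Implicit Defensive.

Local Open Scope classical_set_scope.
Local Open Scope ring_scope.
Local Open Scope complex_scope.

(** * Growth of the weight *)

(** Only the logarithm of the size of the net matters, so its mesh may be any fixed negative power
    of n_j. A mesh of order n_j^(-3) suffices: the bound on |xi_m|, the Lipschitz constant of z^m
    and the number of terms cost one factor n_j each. Blocks may be arbitrarily long: A_j is
    controlled by g(n_j), at the right end, while the decay |z|^(n_{j-1}) comes from the left end.
    The condition g(n_{k+1}) <= C_1 g(n_k) bridges the two. It also makes the a_m grow at most
    polynomially, which gives convergence and analyticity; the block estimates alone control only
    the partial sums that stop at some n_k. *)

Lemma expR_poly_bound (R : realType) (p : nat) (y : R) : 0 <= y ->
  (1 + y) ^+ p <= (2 * p%:R) ^+ p * expR (y / 2).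
Proof.
move=> y0; case: p => [|p].
  by rewrite !expr0 mul1r -(addr0 1) (le_trans _ (expR_ge1Dx _)) // lerD2l divr_ge0.
set q := p.+1%:R; have q1 : 1 <= q :> R by rewrite ler1n.
have q0 : 0 < q by lra.
(* This is [1 + x <= expR x] at x = y/(2q), to be raised to the power q. The exponent y/2 leaves
   half of a decay [expR (- y)] unspent. *)
have H : 1 + y <= 2 * q * expR (y / (2 * q)).
  apply: (@le_trans _ _ (2 * q * (1 + y / (2 * q)))).
    rewrite mulrDr mulr1 mulrCA divff ?mulr1; last by rewrite gt_eqF// mulr_gt0.
    by nra.
  by rewrite ler_pM2l ?mulr_gt0// expR_ge1Dx.
have -> : expR (y / 2) = expR (y / (2 * q)) ^+ p.+1.
  rewrite -expRM_natl; congr expR; rewrite -/q; field; exact: lt0r_neq0.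
by rewrite -exprMn lerXn2r// ?nnegrE ?mulr_ge0 ?expR_ge0//; lra.
Qed.

Lemma geometric_expR_bound (R : realType) (t : R) (M : nat) : 0 < t <= 1 ->
  t * (\sum_(0 <= m < M) expR (- (t * m%:R / 2))) <= 3.
Proof.
move=> /andP[t0 t1].
pose q := expR (- (t / 2)).
have e m : expR (- (t * m%:R / 2)) = q ^+ m.
  by rewrite /q -expRM_natl; congr expR; field.
under eq_bigr do rewrite e.
have q0 : 0 < q by exact: expR_gt0.
(* Since t <= 1, the bound (1 + t/2) q <= 1 gives 1 - q >= (t/2)/(1 + t/2) >= t/3. *)
have q3 : t <= 3 * (1 - q).
  have h : (1 + t / 2) * q <= 1.
    by rewrite -[leRHS](@expR0 R) -(subrr (t / 2)) expRD ler_pM2r// expR_ge1Dx.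
  by nra.
have S0 : 0 <= \sum_(0 <= m < M) q ^+ m.
  by apply: sumr_ge0 => m _; rewrite exprn_ge0 ?ltW.
have E : (1 - q) * \sum_(0 <= m < M) q ^+ m = 1 - q ^+ M.
  elim: M {S0} => [|M IH]; first by rewrite big_nil mulr0 expr0 subrr.
  by rewrite big_nat_recr//= mulrDr IH exprS; ring.
apply: (@le_trans _ _ (3 * (1 - q) * \sum_(0 <= m < M) q ^+ m)).
  by rewrite ler_wpM2r.
rewrite -mulrA E; have := exprn_gt0 M q0; lra.
Qed.

(** Half of the decay r^m <= exp(-(1-r)m) absorbs the polynomial; the other half is kept for summing
    over m. *)
Lemma geometric_poly_bound (R : realType) (p m : nat) (r : R) : 0 <= r < 1 ->
  r ^+ m * (1 + m%:R * (1 - r)) ^+ p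
    <= (2 * p%:R) ^+ p * expR (- ((1 - r) * m%:R / 2)).
Proof.
move=> /andP[r0 r1].
have rexp : r ^+ m <= expR (- ((1 - r) * m%:R)).
  have -> : - ((1 - r) * m%:R) = m%:R * (r - 1) by ring.
  rewrite expRM_natl; apply: lerXn2r; rewrite ?nnegrE ?expR_ge0//.
  by apply: le_trans (expR_ge1Dx _); lra.
have mr : 0 <= m%:R * (1 - r) by rewrite mulr_ge0// subr_ge0 ltW.
apply: (le_trans (ler_pM _ _ rexp (expR_poly_bound p mr))).
- by rewrite exprn_ge0.
- by rewrite exprn_ge0// addr_ge0.
rewrite mulrCA -expRD ler_wpM2l ?exprn_ge0 ?mulr_ge0// ler_expR.
by rewrite le_eqVlt; apply/orP; left; apply/eqP; field.
Qed.

Lemma is_cvg_poly_geometric (R : realType) (q : nat) (rho : R) : 0 <= rho < 1 ->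
  cvgn (series (fun m : nat => m.+1%:R ^+ q * rho ^+ m)).
Proof.
move=> /andP[r0 r1]; set t := 1 - rho; have t0 : 0 < t by rewrite subr_gt0.
have t1 : t <= 1 by rewrite /t; lra.
apply: nondecreasing_is_cvgn.
  apply: nondecreasing_series => m _ _.
  by rewrite mulr_ge0 ?exprn_ge0.
(* Of the q+1 factors t, q turn m+1 into t(m+1) <= 1 + mt, and the last one multiplies the geometric
   sum. *)
exists (3 * (2 * q%:R) ^+ q / t ^+ q.+1) => _ [M _ <-].
rewrite ler_pdivlMr ?exprn_gt0// /series /= exprS mulrC -mulrA mulr_sumr.
apply: le_trans (_ : t * \sum_(0 <= m < M) ((2 * q%:R) ^+ q * expR (- (t * m%:R / 2))) <= _).
  rewrite ler_pM2l//; apply: ler_sum => m _.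
  apply: le_trans (geometric_poly_bound q m _); last by rewrite r0 r1.
  rewrite mulrA mulrC -exprMn ler_wpM2l ?exprn_ge0//.
  have m0 : 0 <= m%:R :> R by [].
  have mt0 : 0 <= m%:R * t by rewrite mulr_ge0// ltW.
  apply: lerXn2r; rewrite ?nnegrE ?(mulr_ge0 (ltW t0)) ?addr_ge0//.
  by rewrite -natr1 mulrDr mulr1 -/t addrC [t * _]mulrC lerD2r.
rewrite -mulr_sumr mulrCA mulrC ler_wpM2r ?exprn_ge0 ?mulr_ge0//.
by apply: geometric_expR_bound; rewrite t0 t1.
Qed.

Section Weight.
Variables (R : realType) (v : R -> R) (hv : weight v).
Local Notation g := (weight_g v).

Let inv_itv (x : R) : 1 <= x -> 0 <= 1 - x^-1 < 1.
Proof.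
move=> x1; have x0 : 0 < x by lra.
rewrite subr_ge0 invf_le1// x1 /= ltrBlDr ltrDl invr_gt0//.
Qed.

Lemma weight_g_gt0 x : 1 <= x -> 0 < g x.
Proof. by move=> x1; apply: (weight_gt0 hv); exact: inv_itv. Qed.

Lemma weight_g_mono x y : 1 <= x -> x <= y -> g x <= g y.
Proof.
move=> x1 xy; have y1 := le_trans x1 xy.
apply: (weight_incr hv).
- by case/andP: (inv_itv x1).
- by rewrite lerD2l lerN2 lef_pV2// posrE; lra.
- by case/andP: (inv_itv y1).
Qed.

Lemma weight_ge1 r : 0 <= r < 1 -> 1 <= v r.
Proof.
by move=> /andP[r0 r1]; rewrite -(weight0 hv); apply: (weight_incr hv).
Qed.

(** The doubling condition on [v] at t = 1/(2x), with D rounded up to a power of two so that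
    iteration produces powers of a ratio of arguments. *)
Lemma weight_g_doubling : exists p : nat, forall x, 1 <= x ->
  g (2 * x) <= 2 ^+ p * g x.
Proof.
have [D hD] := weight_doubling hv.
have [p hp] : exists p : nat, D <= 2 ^+ p.
  exists (Num.bound `|D|); apply: le_trans (ler_norm _) _.
  apply: le_trans (ltW (archi_boundP (normr_ge0 D))) _.
  by rewrite -natrX ler_nat ltnW// ltn_expl.
exists p => x x1; have x0 : 0 < x by lra.
apply: (@le_trans _ _ (D * g x)); last first.
  by rewrite ler_wpM2r// ltW// weight_g_gt0.
rewrite /weight_g.
have -> : 1 - x^-1 = 1 - 2 * (2 * x)^-1 by field; exact: lt0r_neq0.
apply: hD; rewrite invr_gt0 mulr_gt0//= lef_pV2 ?posrE ?mulr_gt0//; lra.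
Qed.

(** As v(r) = g(x) for x = 1/(1-r), this compares g(y) with g(x): by monotonicity if y is small,
    otherwise by about log2(y/x) doublings at a cost 2^p each. The ratio y/x is y(1-r). *)
Lemma weight_g_growth : exists p : nat, forall r y : R, 0 <= r < 1 -> 1 <= y ->
  g y <= 2 ^+ p * (1 + y * (1 - r)) ^+ p * v r.
Proof.
have [p hp] := weight_g_doubling; exists p.
(* [i] bounds the number of doublings that bring x up to y; x < 2y keeps the base 2y/x above 1 even
   once x has passed y. *)
have key i x y : 1 <= x -> 1 <= y -> x < 2 * y -> y <= 2 ^+ i * x ->
    g y <= (2 * y / x) ^+ p * g x.
  elim: i x => [|i IH] x x1 y1 xy yx; have x0 : 0 < x by lra.
    apply: (@le_trans _ _ (g x)).
      by apply: weight_g_mono => //; rewrite expr0 mul1r in yx.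
    rewrite ler_peMl ?(ltW (weight_g_gt0 _))//; apply: exprn_ege1.
    by rewrite ler_pdivlMr// mul1r ltW.
  have [yx1|yx1] := leP y x.
    apply: (@le_trans _ _ (g x)); first exact: weight_g_mono.
    rewrite ler_peMl ?(ltW (weight_g_gt0 _))//; apply: exprn_ege1.
    by rewrite ler_pdivlMr// mul1r ltW.
  have h2 : g y <= (2 * y / (2 * x)) ^+ p * g (2 * x).
    by apply: IH => //; [lra|lra|rewrite mulrA -exprSr].
  apply: (le_trans h2).
  have -> : (2 * y / x) ^+ p = (2 * y / (2 * x)) ^+ p * 2 ^+ p.
    by rewrite -exprMn; congr (_ ^+ _); field; exact: lt0r_neq0.
  rewrite -[leRHS]mulrA; apply: ler_wpM2l; last exact: hp.
    by rewrite exprn_ge0// divr_ge0//; lra.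
move=> r y /andP[r0 r1] y1.
set t := 1 - r; have t0 : 0 < t by rewrite subr_gt0.
have gt : g t^-1 = v r by rewrite /weight_g invrK /t; congr v; ring.
have t1 : 1 <= t^-1 by rewrite invf_ge1// /t; lra.
have vr : 0 < v r by rewrite -gt weight_g_gt0.
have yt : 0 <= y * t by rewrite mulr_ge0// ltW//; lra.
have [yx|yx] := leP (2 * y) t^-1.
  apply: (@le_trans _ _ (v r)).
    by rewrite -gt; apply: weight_g_mono => //; lra.
  rewrite ler_peMl ?(ltW vr)// -exprMn; apply: exprn_ege1; nra.
have [i hi] : exists i : nat, y <= 2 ^+ i * t^-1.
  exists (Num.bound `|y|); apply: (@le_trans _ _ (2 ^+ Num.bound `|y|)); last first.
    by rewrite ler_peMr// exprn_ge0.
  apply: le_trans (ler_norm _) _.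
  apply: le_trans (ltW (archi_boundP (normr_ge0 y))) _.
  by rewrite -natrX ler_nat ltnW// ltn_expl.
have := key i _ _ t1 y1 yx hi; rewrite gt => /le_trans; apply.
rewrite ler_wpM2r ?(ltW vr)// -exprMn lerXn2r// ?nnegrE ?invrK; nra.
Qed.

(** Summation by parts produces r^(n_k) - r^(n_{k+1}), which is (1-r) times the sum of r^m over n_k
    <= m < n_{k+1}; there the partial sum of [A] up to k+1 is at most C1 C2 g(n_k) <= C1 C2 g(m).
    Blocks of any length thus merge into (1-r) times the sum of r^m g(m), which the growth of g
    reduces to a geometric series. *)
Lemma weight_g_sum_bound (C1 : R) (n : nat -> nat) : (0 < n 0)%N ->
  (forall k, (n k < n k.+1)%N) ->
  (forall k, g (n k.+1)%:R <= C1 * g (n k)%:R) -> 0 < C1 ->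
  forall C2 : R, 0 < C2 ->
  exists2 C : R, 0 <= C & forall A : nat -> R, (forall j, 0 <= A j) ->
  (forall k, \sum_(1 <= j < k.+1) A j <= C2 * g (n k)%:R) ->
  forall (r : R) k, 0 <= r < 1 ->
  \sum_(1 <= j < k.+1) r ^+ n j.-1 * A j <= C * v r.
Proof.
move=> n0 hn hg C10 C2 C20.
have npos k : (0 < n k)%N.
  by elim: k => // k IH; rewrite (leq_ltn_trans _ (hn k)).
have [p hp] := weight_g_growth.
pose Kp : R := 2 ^+ p * (2 * p%:R) ^+ p.
have Kp0 : 0 <= Kp by rewrite mulr_ge0 ?exprn_ge0 ?mulr_ge0.
(* The first summand pays for the boundary term of the summation by parts, the second for the
   remaining sum over m. *)
exists (C2 * Kp + 3 * (C1 * C2 * Kp)).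
  by rewrite addr_ge0 ?mulr_ge0// ltW.
move=> A A0 hA r k /[dup] r01 /andP[r0 r1].
have v0 : 0 < v r by rewrite (lt_le_trans ltr01)// weight_ge1.
have rg m : (0 < m)%N -> r ^+ m * g m%:R
    <= Kp * expR (- ((1 - r) * m%:R / 2)) * v r.
  move=> m0; have m1 : 1 <= m%:R :> R by rewrite ler1n.
  apply: le_trans (ler_wpM2l (exprn_ge0 m r0) (hp _ _ r01 m1)) _.
  rewrite mulrA ler_wpM2r ?(ltW v0)//.
  rewrite mulrCA /Kp -(mulrA (2 ^+ p)) ler_wpM2l ?exprn_ge0//.
  exact: geometric_poly_bound.
have tel a b : (a <= b)%N ->
    (1 - r) * \sum_(a <= m < b) r ^+ m = r ^+ a - r ^+ b.
  move=> ab; rewrite mulr_sumr (_ : r ^+ a - r ^+ b = - r ^+ b - - r ^+ a); last by ring.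
  apply: (@telescope_sumr_eq _ a b (fun m => - r ^+ m)) => // m _.
  by rewrite exprS; ring.
pose S k := \sum_(1 <= j < k.+1) A j.
have abel : \sum_(1 <= j < k.+1) r ^+ n j.-1 * A j <= r ^+ n k * S k
    + C1 * C2 * ((1 - r) * \sum_(n 0 <= m < n k) r ^+ m * g m%:R).
  elim: k => [|k IH].
    by rewrite /S !big_geq// !mulr0 addr0.
  rewrite big_nat_recr//=.
  apply: (@le_trans _ _ (r ^+ n k * S k.+1 + C1 * C2 *
      ((1 - r) * \sum_(n 0 <= m < n k) r ^+ m * g m%:R))).
    rewrite [S k.+1]big_nat_recr//= mulrDr.
    by rewrite [leRHS]addrAC lerD2r.
  have n0k : (n 0 <= n k)%N.
    by elim: (k) => // k' IH'; rewrite (leq_trans IH' (ltnW (hn k'))).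
  rewrite [leRHS](_ : _ = r ^+ n k.+1 * S k.+1 +
     C1 * C2 * ((1 - r) * \sum_(n k <= m < n k.+1) r ^+ m * g m%:R) +
     C1 * C2 * ((1 - r) * \sum_(n 0 <= m < n k) r ^+ m * g m%:R)); last first.
    by rewrite (big_cat_nat n0k (ltnW (hn k)))/=; ring.
  rewrite lerD2r -lerBlDl -mulrBl.
  apply: (@le_trans _ _ ((r ^+ n k - r ^+ n k.+1) * (C1 * C2 * g (n k)%:R))).
    apply: ler_wpM2l; first by rewrite subr_ge0 (ler_wiXn2l r0 (ltW r1))// ltnW.
    rewrite mulrAC mulrC; apply: le_trans (hA _) _.
    by rewrite ler_wpM2l// ltW.
  rewrite mulrCA ler_wpM2l ?mulr_ge0 ?(ltW C10) ?(ltW C20)//.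
  apply: (@le_trans _ _ ((1 - r) * \sum_(n k <= m < n k.+1) r ^+ m * g (n k)%:R)).
    by rewrite -mulr_suml mulrA tel// ltnW.
  rewrite ler_wpM2l ?subr_ge0 ?(ltW r1)//; apply: ler_sum_nat => m /andP[nm _].
  by rewrite ler_wpM2l ?exprn_ge0// weight_g_mono ?ler_nat ?ler1n.
apply: (le_trans abel); rewrite [leRHS]mulrDl; apply: lerD.
  apply: (@le_trans _ _ (C2 * (r ^+ n k * g (n k)%:R))).
    by rewrite mulrCA ler_wpM2l ?exprn_ge0// hA.
  rewrite -mulrA ler_wpM2l ?(ltW C20)//; apply: (le_trans (rg _ (npos k))).
  rewrite ler_wpM2r ?(ltW v0)// ler_piMr// -[leRHS]expR0 ler_expR oppr_le0.
  by rewrite divr_ge0// mulr_ge0// subr_ge0 ltW.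
rewrite [leRHS](_ : _ = C1 * C2 * (3 * Kp * v r)); last by ring.
rewrite ler_wpM2l ?mulr_ge0 ?(ltW C10) ?(ltW C20)//.
apply: (@le_trans _ _ ((1 - r) *
  \sum_(0 <= m < n k) Kp * expR (- ((1 - r) * m%:R / 2)) * v r)).
  rewrite ler_wpM2l ?subr_ge0 ?(ltW r1)//.
  have n0k : (n 0 <= n k)%N.
    by elim: (k) => // k' IH'; rewrite (leq_trans IH' (ltnW (hn k'))).
  rewrite (big_cat_nat (leq0n (n 0)) n0k)/=.
  apply: (@le_trans _ _ (\sum_(n 0 <= m < n k)
      Kp * expR (- ((1 - r) * m%:R / 2)) * v r)).
    apply: ler_sum_nat => m /andP[nm _]; apply: rg; exact: leq_trans nm.
  by rewrite lerDr; apply: sumr_ge0 => m _; rewrite !mulr_ge0 ?expR_ge0 ?(ltW v0).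
rewrite -mulr_suml -mulr_sumr mulrA ler_wpM2r ?(ltW v0)// mulrCA mulrC.
rewrite ler_wpM2r//; apply: geometric_expR_bound.
by rewrite subr_gt0 r1/=; lra.
Qed.

End Weight.

(** * Subnormal sequences *)

Section Independence.
Context (d : measure_display) (T : measurableType d) (R : realType).
Variable P : probability T R.

Import HBNNSimple.

(** The last hypothesis is independence tested on events X in B; linearity extends it to simple
    functions and monotone convergence to [f]. [H] is abstract so that it can stand for the product
    of all other factors. *)
Lemma ge0_integral_indep (H : T -> R) (X : {RV P >-> R}) (f : R -> R) :
  measurable_fun setT H -> (forall x, 0 <= H x) ->
  measurable_fun setT f -> (forall y, 0 <= f y) ->
  (\int[P]_x (H x)%:E < +oo)%E ->
  (forall B, measurable B ->
     (\int[P]_x (H x * \1_B (X x))%:E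
       = (\int[P]_x (H x)%:E) * P (X @^-1` B))%E) ->
  (\int[P]_x (H x * f (X x))%:E
    = (\int[P]_x (H x)%:E) * \int[P]_x (f (X x))%:E)%E.
Proof.
move=> mH H0 mf f0 Hfin hB.
have mX : measurable_fun setT X by exact: measurable_funP.
have mpre (g : {nnsfun R >-> R}) : measurable_fun setT (g \o X).
  by apply: measurableT_comp => //; exact: measurable_funP.
pose J := (\int[P]_x (H x)%:E)%E.
have J0 : (0 <= J)%E by apply: integral_ge0 => x _; rewrite lee_fin.
have simple (g : {nnsfun R >-> R}) :
    (\int[P]_x (H x * g (X x))%:E = J * \int[P]_x (g (X x))%:E)%E.
  have gE y : g y = \sum_(c <- finmap.enum_fset (fset_set (range g))) c * \1_(g @^-1` [set c]) y.
    by rewrite {1}(fimfunE g) fsbig_finite.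
  have mI c : measurable_fun setT (fun x => \1_(g @^-1` [set c]) (X x) : R).
    by apply: measurableT_comp => //; exact: measurable_indic.
  have g0 c y : 0 <= c * \1_(g @^-1` [set c]) y.
    rewrite indicE; case: (boolP (y \in _)); rewrite ?mulr0// mulr1.
    by rewrite inE => /= <-.
  under eq_integral => x _ do rewrite gE mulr_sumr -sumEFin.
  rewrite ge0_integral_sum//; last 2 first.
  - move=> c; apply/measurable_EFinP; apply: measurable_funM => //.
    by apply: measurable_funM => //; exact: measurable_cst.
  - by move=> c x _; rewrite lee_fin mulr_ge0.
  under [in RHS]eq_integral => x _ do rewrite gE -sumEFin.
  rewrite ge0_integral_sum//; last 2 first.
  - move=> c; apply/measurable_EFinP.
    by apply: measurable_funM => //; exact: measurable_cst.
  - by move=> c x _; rewrite lee_fin.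
  rewrite ge0_sume_distrr; last first.
    by move=> c _; apply: integral_ge0 => x _; rewrite lee_fin.
  apply: eq_bigr => c _.
  (* The sum does not remember that c is a value of [g]; a negative c has empty preimage and both
     sides vanish. *)
  have [c0|c0] := ltP c 0.
    have z y : \1_(g @^-1` [set c]) y = 0 :> R.
      rewrite indicE; case: (boolP (y \in _)) => //; rewrite inE => /= gyc.
      by move: c0; rewrite -gyc ltNge fun_ge0.
    under eq_integral => x _ do rewrite z !mulr0.
    under [in RHS]eq_integral => x _ do rewrite z mulr0.
    by rewrite integral0 mule0.
  under eq_integral => x _ do rewrite mulrCA EFinM.
  under [in RHS]eq_integral => x _ do rewrite EFinM.
  rewrite !ge0_integralZl_EFin//; last 3 first.
  - exact/measurable_EFinP.
  - by move=> x _; rewrite lee_fin mulr_ge0.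
  - by apply/measurable_EFinP; exact: measurable_funM.
  rewrite hB; last by rewrite -[_ @^-1` _]setTI; exact: measurable_funP.
  rewrite muleCA; congr (_ * (_ * _))%E.
  have -> : (fun x => (\1_(g @^-1` [set c]) (X x))%:E) =
     (fun x => (\1_(X @^-1` (g @^-1` [set c])) x)%:E :> \bar R) by [].
  rewrite integral_indic ?setIT//.
  by rewrite -[X in measurable X]setTI; apply: mX => //;
     rewrite -[X in measurable X]setTI; exact: measurable_funP.
have mEf : measurable_fun setT (EFin \o f) by exact/measurable_EFinP.
pose g := nnsfun_approx measurableT mEf.
have cvgg y : EFin \o g^~ y @ \oo --> (EFin \o f) y.
  by apply: cvg_nnsfun_approx => // z _; rewrite lee_fin.
have ndg y : nondecreasing_seq (g^~ y).
  by move=> m n mn; apply/lefP; exact: nd_nnsfun_approx.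
have E1 : (\int[P]_x (H x * f (X x))%:E
    = limn (fun n => \int[P]_x (H x * g n (X x))%:E))%E.
  rewrite -monotone_convergence//; last 3 first.
  - by move=> n; apply/measurable_EFinP; exact: measurable_funM mH (mpre (g n)).
  - by move=> n x _; rewrite lee_fin mulr_ge0.
  - by move=> x _ m n mn; rewrite lee_fin ler_wpM2l// ndg.
  apply: eq_integral => x _; apply/esym/cvg_lim => //.
  under eq_fun do rewrite EFinM.
  by rewrite EFinM; apply: cvgeZl => //; exact: cvgg.
have E2 : (\int[P]_x (f (X x))%:E
    = limn (fun n => \int[P]_x (g n (X x))%:E))%E.
  rewrite -monotone_convergence//; last 3 first.
  - by move=> n; apply/measurable_EFinP; exact: (mpre (g n)).
  - by move=> n x _; rewrite lee_fin.
  - by move=> x _ m n mn; rewrite lee_fin ndg.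
  by apply: eq_integral => x _; apply/esym/cvg_lim => //; exact: cvgg.
rewrite E1 E2; under eq_fun do rewrite simple.
apply: limeMl; first by rewrite ge0_fin_numE.
apply: ereal_nondecreasing_is_cvgn => m n mn; apply: ge0_le_integral => //.
- by move=> x _; rewrite lee_fin.
- by apply/measurable_EFinP; exact: (mpre (g m)).
- by apply/measurable_EFinP; exact: (mpre (g n)).
- by move=> x _; rewrite lee_fin ndg.
Qed.

(** Independence is given on events, so the induction runs over mixed products [G] with functions on
    [s] and indicators on [s']. For empty [s] this is the definition; each step turns one indicator
    into a function. *)
Lemma integral_prod_indep (X : nat -> {RV P >-> R}) (hX : independent_RVs X)
    (f : nat -> R -> R) (s : seq nat) :
  uniq s -> (forall i, measurable_fun setT (f i)) -> (forall i y, 0 <= f i y) ->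
  (forall i, (\int[P]_x (f i (X i x))%:E < +oo)%E) ->
  (\int[P]_x (\prod_(i <- s) f i (X i x))%:E
    = \prod_(i <- s) \int[P]_x (f i (X i x))%:E)%E.
Proof.
move=> us mf f0 ffin.
have mX i : measurable_fun setT (X i) by exact: measurable_funP.
have mpre i (B : set R) : measurable B -> measurable (X i @^-1` B).
  by move=> mB; rewrite -[X in measurable X]setTI; exact: mX.
have I0 i : (0 <= \int[P]_x (f i (X i x))%:E)%E.
  by apply: integral_ge0 => x _; rewrite lee_fin.
have mI i (B : set R) : measurable B ->
    measurable_fun setT (fun x => \1_B (X i x) : R).
  by move=> mB; apply: measurableT_comp => //; exact: measurable_indic.
pose G s s' (B : nat -> set R) x :=
  (\prod_(i <- s) f i (X i x)) * \prod_(i <- s') \1_(B i) (X i x).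
have mG s1 s' B : (forall i, measurable (B i)) -> measurable_fun setT (G s1 s' B).
  move=> mB; apply: measurable_funM; apply: measurable_prod => i _.
    exact: measurableT_comp.
  exact: mI.
have G0 s1 s' B x : 0 <= G s1 s' B x.
  by apply: mulr_ge0; apply: prodr_ge0 => i _ //; rewrite indicE.
suff key s' B : uniq (s ++ s') -> (forall i, measurable (B i)) ->
    (\int[P]_x (G s s' B x)%:E = (\prod_(i <- s) \int[P]_x (f i (X i x))%:E)
       * \prod_(i <- s') P (X i @^-1` B i))%E.
  have := key [::] (fun=> setT); rewrite cats0 big_nil mule1 => <- //.
  by apply: eq_integral => x _; rewrite /G big_nil mulr1.
elim: s s' B {us} => [|k s IH] s' B us mB.
  rewrite big_nil mul1e -hX//.
  rewrite -[X in P X]setIT -integral_indic//; last first.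
    by apply: fin_bigcap_measurable => // i _; exact: mpre.
  apply: eq_integral => x _; rewrite /G big_nil mul1r; congr EFin.
  rewrite bigcap_seq; elim: s' {us} => [|i s' IHs].
    by rewrite !big_nil indicT.
  by rewrite !big_cons indicI/= IHs.
have usB : uniq (s ++ k :: s').
  by rewrite -cat1s uniq_catCA.
have us' : uniq (s ++ s') by move: us => /= /andP[].
have ks' : k \notin s' by move: us; rewrite /= mem_cat negb_or => /andP[/andP[]].
rewrite big_cons -muleA [RHS]muleC.
transitivity (\int[P]_x (G s s' B x * f k (X k x))%:E)%E.
  by apply: eq_integral => x _; rewrite /G big_cons; congr EFin; ring.
have JE := IH s' B us' mB.
rewrite ge0_integral_indep//; first by rewrite JE.
- exact: mG.
- rewrite JE ltey_eq fin_numM//; apply: (big_ind (fun e : \bar R => e \is a fin_num)) => //.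
  + exact: fin_numM.
  + by move=> i _; rewrite ge0_fin_numE.
  + exact: fin_numM.
  + by move=> i _; apply: fin_num_measure; exact: mpre.
- move=> C mC.
  (* Since [k] is not in [s'], overriding [B] at [k] changes no other factor, and the event X_k in C
     becomes one more indicator. *)
  pose B' i := if i == k then C else B i.
  have mB' i : measurable (B' i) by rewrite /B'; case: ifP.
  rewrite JE; transitivity (\int[P]_x (G s (k :: s') B' x)%:E)%E.
    apply: eq_integral => x _; rewrite /G big_cons {1}/B' eqxx; congr EFin.
    rewrite -mulrA; congr (_ * _); rewrite mulrC; congr (_ * _).
    apply: eq_big_seq => i si; rewrite /B'; case: eqP => // ik.
    by rewrite -ik si in ks'.
  rewrite IH// big_cons {1}/B' eqxx -muleA; congr (_ * _)%E.
  rewrite muleC; congr (_ * _)%E.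
  apply: eq_big_seq => i si; rewrite /B'; case: eqP => // ik.
  by rewrite -ik si in ks'.
Qed.

(** The exponential of the sum factors by independence, and subnormality of X_i is used at lambda =
    b_i: the combination is dominated by a Gaussian of variance sum b_i^2. *)
Lemma subnormal_expectation_exp (X : nat -> {RV P >-> R})
    (hX : subnormal_sequence X) (b : nat -> R) (s : seq nat) : uniq s ->
  (\int[P]_x (expR (\sum_(i <- s) b i * X i x))%:E
    <= (expR ((\sum_(i <- s) b i ^+ 2) / 2))%:E)%E.
Proof.
case: hX => indep sub us.
have mgf i : (\int[P]_x (expR (b i * X i x))%:E <= (expR (b i ^+ 2 / 2))%:E)%E.
  have := sub i (b i); rewrite /mmt_gen_fun unlock; apply: le_trans.
  by rewrite le_eqVlt; apply/orP; left; apply/eqP; apply: eq_integral => x _ /=;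
    rewrite mulrC.
rewrite (eq_integral (fun x => (\prod_(i <- s) expR (b i * X i x))%:E)); last first.
  by move=> x _; rewrite expR_sum.
rewrite (integral_prod_indep indep (f := fun i y => expR (b i * y)))//.
- rewrite mulr_suml expR_sum.
  elim: s {us} => [|i s IH]; first by rewrite !big_nil.
  rewrite !big_cons EFinM lee_pmul//.
  + by apply: integral_ge0 => x _; rewrite lee_fin expR_ge0.
  + apply: (big_ind (fun e : \bar R => (0 <= e)%E)) => //; first exact: mule_ge0.
    by move=> k _; apply: integral_ge0 => x _; rewrite lee_fin expR_ge0.
- by move=> i; apply: measurableT_comp => //; exact: measurable_funM.
- by move=> i; apply: le_lt_trans (mgf i) _; rewrite ltry.
Qed.

End Independence.

Lemma sum_inv_sq_le (R : realType) (N : nat) :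
  \sum_(0 <= n < N) (n.+1%:R ^- 2 : R) <= 2.
Proof.
(* Telescoping by 1/(n+1)^2 <= 1/n - 1/(n+1) for n >= 1; at N = 0 the inverse is 0 by convention. *)
suff H : \sum_(0 <= n < N) (n.+1%:R ^- 2 : R) <= 2 - N%:R^-1.
  by apply: le_trans H _; rewrite gerBl invr_ge0.
elim: N => [|[|N] IH]; first by rewrite big_geq// invr0; lra.
  by rewrite big_nat1 expr1n invr1; lra.
rewrite big_nat_recr//=; apply: le_trans (lerD IH (lexx _)) _.
have N0 : 0 <= N%:R :> R by [].
rewrite -(natr1 N.+1) -(natr1 N).
rewrite -subr_ge0 [leRHS](_ : _ = ((N%:R + 1) * (N%:R + 1 + 1) ^+ 2)^-1).
  by rewrite invr_ge0 mulr_ge0 ?exprn_ge0//; lra.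
by field; rewrite !lt0r_neq0//; lra.
Qed.

Section AE.
Context (d : measure_display) (T : measurableType d) (R : realType).
Variable P : probability T R.

(** The sum of the F_n has integral at most 2C, so it is finite almost everywhere, and it dominates
    each of its nonnegative terms. This takes the place of a Borel-Cantelli argument. *)
Lemma ae_bounded_of_summable (F : nat -> T -> R) (C : R) :
  (forall n, measurable_fun setT (F n)) -> (forall n x, 0 <= F n x) ->
  (forall n, (\int[P]_x (F n x)%:E <= (C * n.+1%:R ^- 2)%:E)%E) ->
  {ae P, forall x, exists Y : R, forall n, F n x <= Y}.
Proof.
move=> mF F0 hF.
have C0 : 0 <= C.
  have := hF 0; rewrite expr1n invr1 mulr1 => h.
  by rewrite -lee_fin (le_trans _ h)// integral_ge0// => x _; rewrite lee_fin.
pose S : T -> \bar R := fun x => (\sum_(n <oo) (F n x)%:E)%E.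
have mS : measurable_fun setT S.
  apply: ge0_emeasurable_sum => // k; first by move=> x _; rewrite lee_fin.
  by move=> _; exact/measurable_EFinP.
have S0 x : (0 <= S x)%E by apply: nneseries_ge0 => n _ _; rewrite lee_fin.
have : (\int[P]_x S x <= (C * 2)%:E)%E.
  rewrite integral_nneseries//; last first.
  - by move=> n x _; rewrite lee_fin.
  - by move=> n; exact/measurable_EFinP.
  apply: lime_le.
    by apply: is_cvg_nneseries => n _ _; apply: integral_ge0 => x _; rewrite lee_fin.
  apply: nearW => N.
  apply: le_trans (_ : (\sum_(0 <= n < N) (C * n.+1%:R ^- 2)%:E <= _)%E).
    by apply: lee_sum => n _; exact: hF.
  by rewrite sumEFin lee_fin -mulr_sumr ler_wpM2l// sum_inv_sq_le.
move=> hS.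
have iS : P.-integrable setT S.
  apply/integrableP; split => //.
  under eq_integral => x _ do rewrite gee0_abs//.
  by apply: le_lt_trans hS _; rewrite ltry.
have := integrable_ae measurableT iS.
apply: filterS => x /(_ I) Sfin.
exists (fine (S x)) => n; rewrite -lee_fin fineK//.
apply: le_trans (nneseries_lim_ge n.+1 _); last by move=> k _ _; rewrite lee_fin.
by rewrite sumEFin lee_fin big_nat_recr//= lerDr sumr_ge0.
Qed.

End AE.

Section Net.
Context (d : measure_display) (T : measurableType d) (R : realType).
Variable P : probability T R.

(* The exponential moments of all the sums, weighted by a power of [N j], are
   summable, which bounds all of them at once almost surely. *)
Lemma ae_subnormal_net (X : nat -> {RV P >-> R}) (hX : subnormal_sequence X)
    (I : nat -> finType) (s : nat -> seq nat) (b : forall j, I j -> nat -> R)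
    (B : nat -> R) (N : nat -> nat) (q : nat) (K0 : R) :
  (forall j, uniq (s j)) -> (forall j, 0 <= B j) -> (forall j, (j.+2 <= N j)%N) ->
  (forall j i, \sum_(m <- s j) b j i m ^+ 2 <= B j ^+ 2) ->
  (forall j, #|I j|%:R <= K0 * (N j)%:R ^+ q) ->
  {ae P, forall x, exists2 Y : R, 0 <= Y & forall j i,
     \sum_(m <- s j) b j i m * X m x <= Y * (B j * Num.sqrt (ln (N j)%:R))}.
Proof.
move=> us B0 Nj hb hI.
pose l j : R := Num.sqrt (ln (N j)%:R).
have N2 j : 2 <= (N j)%:R :> R.
  by rewrite ler_nat (leq_trans _ (Nj j)).
have lnN j : 0 < ln (N j)%:R :> R by rewrite ln_gt0//; have := N2 j; lra.
have l2 j : l j ^+ 2 = ln (N j)%:R by rewrite sqr_sqrtr// ltW.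
have l0 j : 0 < l j by rewrite sqrtr_gt0.
pose Z j i x := \sum_(m <- s j) b j i m * X m x.
(* With this parameter the exponential moment is at most exp(l_j^2 / 2) <= N_j; for B_j = 0 the
   quotient is 0 and the bound persists. *)
pose c j := l j / B j.
have mZ j i : measurable_fun setT (Z j i).
  apply: measurable_sum => m; apply: measurable_funM => //.
have EZ j i : (\int[P]_x (expR (c j * Z j i x))%:E <= (N j)%:R%:E)%E.
  under eq_integral => x _.
    rewrite /Z mulr_sumr; under eq_bigr do rewrite mulrA; over.
  apply: le_trans (subnormal_expectation_exp hX (fun m => c j * b j i m) (us j)) _.
  rewrite lee_fin -[leRHS]lnK ?posrE ?ltr0n; last by rewrite (leq_trans _ (Nj j)).
  rewrite ler_expR -l2; under eq_bigr do rewrite exprMn.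
  rewrite -mulr_sumr.
  apply: (@le_trans _ _ (c j ^+ 2 * B j ^+ 2 / 2)).
    by rewrite ler_wpM2r// ler_wpM2l ?sqr_ge0.
  rewrite -exprMn /c; have [->|B1] := eqVneq (B j) 0.
    by rewrite mulr0 expr0n/= mul0r sqr_ge0.
  by rewrite divfK//; have := sqr_ge0 (l j); lra.
(* At most K0 N^q moments, each at most N, leave |K0| N^(-2), which is summable because N_j >= j +
   2. *)
pose F j x := (N j)%:R ^- q.+3 * \sum_(i : I j) expR (c j * Z j i x).
have mE j i : measurable_fun setT (fun x => expR (c j * Z j i x)).
  by apply: measurableT_comp => //; apply: measurable_funM.
have : {ae P, forall x, exists Y : R, forall j, F j x <= Y}.
  apply: (@ae_bounded_of_summable _ _ _ _ _ `|K0|).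
  - by move=> j; apply: measurable_funM => //; apply: measurable_sum.
  - move=> j x; rewrite mulr_ge0 ?invr_ge0 ?exprn_ge0//.
    by apply: sumr_ge0 => i _; exact: expR_ge0.
  - move=> j; under eq_integral => x _ do rewrite EFinM -sumEFin.
    rewrite ge0_integralZl//; last 2 first.
    + by apply: emeasurable_sum => i; exact/measurable_EFinP.
    + by move=> x _; apply: sume_ge0 => i _; rewrite lee_fin expR_ge0.
    rewrite ge0_integral_sum//; last by move=> i; exact/measurable_EFinP.
    apply: (@le_trans _ _ (((N j)%:R ^- q.+3)%:E * \sum_(i : I j) (N j)%:R%:E)%E).
      rewrite lee_pmul2l ?lte_fin ?invr_gt0 ?exprn_gt0//.
        by apply: lee_sum => i _; exact: EZ.
      by rewrite ltr0n (leq_trans _ (Nj j)).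
    rewrite sumEFin -EFinM lee_fin.
    rewrite [X in _ * X <= _](_ : _ = (N j)%:R * #|I j|%:R); last first.
      by rewrite sumr_const mulr_natr.
    have N0 : 0 < (N j)%:R :> R by have := N2 j; lra.
    apply: (@le_trans _ _ (`|K0| * (N j)%:R ^- 2)).
      rewrite -ler_pdivlMl ?invr_gt0 ?exprn_gt0// invrK.
      rewrite [leRHS](_ : _ = (N j)%:R * (`|K0| * (N j)%:R ^+ q)); last first.
        by rewrite -addn3 exprD; field; exact: lt0r_neq0.
      rewrite ler_pM2l//; apply: le_trans (hI j) _.
      by rewrite ler_wpM2r ?exprn_ge0// ler_norm.
    rewrite ler_wpM2l// lef_pV2 ?posrE ?exprn_gt0// lerXn2r ?nnegrE//.
    by rewrite ler_nat ltnW.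
apply: filterS => x [Y0 hY0].
pose Y := Num.max Y0 1.
have Y1 : 1 <= Y by rewrite le_max lexx orbT.
have YY0 : Y0 <= Y by rewrite le_max lexx.
have ln2 : 0 < ln 2 :> R by rewrite ln_gt0//; lra.
have lY : 0 <= ln Y by rewrite ln_ge0.
(* Dividing c Z <= ln Y + (q+3) l^2 by c = l/B gives Z <= (ln Y / l^2 + q + 3) B l, and l^2 >= ln
   2. *)
exists (ln Y / ln 2 + q.+3%:R).
  by rewrite addr_ge0// divr_ge0// ltW.
move=> j i; rewrite -/(l j) -/(Z j i x).
have N0 : 0 < (N j)%:R :> R by have := N2 j; lra.
have hexp : expR (c j * Z j i x) <= Y * (N j)%:R ^+ q.+3.
  rewrite -ler_pdivrMr ?exprn_gt0// mulrC; apply: le_trans YY0.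
  apply: le_trans (hY0 j); rewrite ler_wpM2l ?invr_ge0 ?exprn_ge0//.
  rewrite (bigD1 i)//= lerDl; apply: sumr_ge0 => k _; exact: expR_ge0.
have hcZ : c j * Z j i x <= ln Y + q.+3%:R * l j ^+ 2.
  rewrite -ler_expR; apply: le_trans hexp _.
  rewrite expRD lnK ?posrE; last by lra.
  by rewrite l2 expRM_natl lnK ?posrE.
(* Here c_j = 0 makes the exponential bound empty, but all coefficients of the block vanish. *)
have [Bz|Bn] := eqVneq (B j) 0.
  have bz : forall m, m \in s j -> b j i m = 0.
    have : \sum_(m <- s j) b j i m ^+ 2 = 0.
      apply/eqP; rewrite eq_le; apply/andP; split.
        by apply: le_trans (hb j i) _; rewrite Bz expr0n.
      by apply: sumr_ge0 => m _; exact: sqr_ge0.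
    move/eqP; rewrite psumr_eq0; last by move=> m _; exact: sqr_ge0.
    by move=> /allP h m /h /=; rewrite sqrf_eq0 => /eqP.
  by rewrite Bz mul0r mulr0 /Z big1_seq// => m /andP[_ /bz ->]; rewrite mul0r.
have Bp : 0 < B j by rewrite lt_def Bn B0.
have -> : Z j i x = (c j * Z j i x) * (B j / l j).
  by rewrite /c; field; rewrite Bn lt0r_neq0.
apply: (@le_trans _ _ ((ln Y + q.+3%:R * l j ^+ 2) * (B j / l j))).
  by rewrite ler_wpM2r// divr_ge0// ltW.
rewrite [leLHS](_ : _ = (ln Y / l j ^+ 2 + q.+3%:R) * (B j * l j)); last first.
  by field; exact: lt0r_neq0.
rewrite ler_wpM2r ?(mulr_ge0 (ltW Bp) (ltW (l0 j)))// lerD2r ler_wpM2l//.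
rewrite lef_pV2 ?posrE ?exprn_gt0// l2 ler_ln ?posrE//.
Qed.

(** Blocks of a single term, with the two signs as net, give the rate sqrt(log(m+2)), which is then
    weakened to m + 2. *)
Lemma ae_subnormal_linear_growth (X : nat -> {RV P >-> R})
    (hX : subnormal_sequence X) :
  {ae P, forall x, exists2 Y : R, 0 <= Y & forall m, `|X m x| <= Y * m.+2%:R}.
Proof.
have := @ae_subnormal_net X hX (fun=> bool) (fun j => [:: j])
  (fun j i _ => if i then 1 else -1) (fun=> 1) (fun j => j.+2) 0 2.
move=> /(_ _ _ _ _ _)/wrap[]//.
- by move=> j i; rewrite big_seq1; case: i; rewrite ?sqrrN expr1n.
- by move=> j; rewrite card_bool expr0 mulr1.
apply: filterS => x [Y Y0 hY]; exists Y => // m.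
have hm : 1 * Num.sqrt (ln m.+2%:R) <= m.+2%:R :> R.
  rewrite mul1r -[leRHS](@ger0_norm _ m.+2%:R)// -sqrtr_sqr ler_sqrt ?sqr_ge0//.
  apply: le_trans (ltW (ln_sublinear _)) _ => //.
  by rewrite -natrX ler_nat expnS leq_pmulr.
rewrite ler_norml lerNl; apply/andP; split.
  have := hY m false; rewrite big_seq1 mulN1r => /le_trans; apply.
  by rewrite ler_wpM2l.
rewrite -[X m x]mul1r; have := hY m true; rewrite big_seq1 => /le_trans; apply.
by rewrite ler_wpM2l.
Qed.

End Net.

(** * Complex power series *)

Section ComplexModulus.
Variable R : realType.
Implicit Types z w : R[i].

Lemma normc_ge0 z : 0 <= normc z.
Proof. by case: z => a b; exact: sqrtr_ge0. Qed.

Lemma normcB z w : normc (z - w) = normc (w - z).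
Proof. by rewrite -opprB normcN. Qed.

Lemma normcX z m : normc (z ^+ m) = normc z ^+ m.
Proof.
elim: m => [|m IH]; first by rewrite !expr0 ComplexField.Normc.normc1.
by rewrite !exprS ComplexField.Normc.normcM IH.
Qed.

Lemma normc_real (x : R) : normc x%:C = `|x|.
Proof. by rewrite /= expr0n/= addr0 sqrtr_sqr. Qed.

Lemma normc_nat (m : nat) : normc (m%:R : R[i]) = m%:R.
Proof. by rewrite -[in LHS](rmorph_nat (real_complex R)) normc_real ger0_norm. Qed.

Lemma ler_Re_normc z : `|complex.Re z| <= normc z.
Proof. by have := normc_ge_Re z; rewrite lecR. Qed.

Lemma ler_Im_normc z : `|complex.Im z| <= normc z.
Proof.
case: z => a b /=; rewrite -sqrtr_sqr ler_sqrt ?addr_ge0 ?sqr_ge0//.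
by rewrite lerDr sqr_ge0.
Qed.

Lemma normc_le_ReIm z : normc z <= `|complex.Re z| + `|complex.Im z|.
Proof.
case: z => a b /=; rewrite -[leRHS]ger0_norm ?addr_ge0// -sqrtr_sqr.
rewrite ler_sqrt ?sqr_ge0// sqrrD !real_normK ?num_real//.
have := mulr_ge0 (normr_ge0 a) (normr_ge0 b); lra.
Qed.

Lemma normc_sum (I : Type) (s : seq I) (Q : pred I) (F : I -> R[i]) :
  normc (\sum_(i <- s | Q i) F i) <= \sum_(i <- s | Q i) normc (F i).
Proof.
apply: (big_ind2 (fun x y => normc x <= y)) => //.
- by rewrite ComplexField.Normc.normc0.
- by move=> x1 x2 y1 y2 h1 h2; apply: le_trans (le_normcD _ _) _; exact: lerD.
Qed.

(** A positive element of [R[i]] is real, so real tolerances suffice. *)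
Lemma cvg_normcP (T : Type) (F : set_system T) (FF : Filter F)
    (u : T -> R[i]^o) (l : R[i]) :
  u @ F --> (l : R[i]^o) <->
  forall e : R, 0 < e -> \forall x \near F, normc (l - u x) <= e.
Proof.
split=> [/cvgrPdist_le h e e0|h].
  have := h e%:C; rewrite ltcR => /(_ e0); apply: filterS => x.
  by rewrite -lecR.
apply/cvgrPdist_le => -[e e'] /[dup]; rewrite {1}ltcE /= => /andP[/eqP-> e0] _.
by have := h e e0; apply: filterS => x; rewrite -lecR.
Qed.

Lemma abs_summable_cvg (t : nat -> R[i]) :
  cvgn (series (fun m => normc (t m))) ->
  cvgn ((fun N => \sum_(0 <= m < N) t m) : nat -> R[i]^o).
Proof.
move=> ct.
have cRe : cvgn (series (fun m => complex.Re (t m))).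
  apply: normed_cvg; apply: (series_le_cvg _ _ _ ct) => m.
  - exact: normr_ge0.
  - exact: normc_ge0.
  - exact: ler_Re_normc.
have cIm : cvgn (series (fun m => complex.Im (t m))).
  apply: normed_cvg; apply: (series_le_cvg _ _ _ ct) => m.
  - exact: normr_ge0.
  - exact: normc_ge0.
  - exact: ler_Im_normc.
apply/cvg_ex; exists (limn (series (fun m => complex.Re (t m))) +i*
  limn (series (fun m => complex.Im (t m)))).
apply/cvg_normcP => e e0; have e20 : 0 < e / 2 by lra.
move/cvgrPdist_le : cRe => /(_ _ e20) h1; move/cvgrPdist_le : cIm => /(_ _ e20) h2.
have sE N : \sum_(0 <= m < N) t m = series (fun m => complex.Re (t m)) N +i*
    series (fun m => complex.Im (t m)) N.
  rewrite /series /=; elim: N => [|N IH]; first by rewrite !big_geq.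
  by rewrite !big_nat_recr//= IH; case: (t N).
near=> N.
rewrite sE; apply: le_trans (normc_le_ReIm _) _ => /=.
rewrite (splitr e); apply: lerD.
- by near: N.
- by near: N.
Unshelve. all: by end_near. Qed.

(** Bounding infinitely many terms is enough, which suits partial sums that stop at the end of a
    block. *)
Lemma cvg_normc_le (u : nat -> R[i]^o) (l : R[i]) (C : R) :
  u @ \oo --> (l : R[i]^o) -> (forall M, exists2 N, (M <= N)%N & normc (u N) <= C) ->
  normc l <= C.
Proof.
move=> /cvg_normcP ul hC; apply/ler_addgt0Pr => e e0.
have [M _ hM] := ul e e0; have [N MN uN] := hC M.
rewrite -(subrK (u N) l) addrC; apply: le_trans (le_normcD _ _) _.
by rewrite lerD// (hM N).
Qed.

(** The remainder satisfies T_{m+1} = w T_m + m z^(m-1) (w-z)^2, and m^2 + m <= (m+1)^2 closes the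
    induction. Having rho^2 on the left avoids the exponent m - 2. *)
Lemma power_taylor_remainder (z w : R[i]) (rho : R) (m : nat) : 0 < rho ->
  normc z <= rho -> normc w <= rho ->
  normc (w ^+ m - z ^+ m - m%:R * z ^+ m.-1 * (w - z)) * rho ^+ 2
    <= m%:R ^+ 2 * rho ^+ m * normc (w - z) ^+ 2.
Proof.
move=> rho0 zr wr; elim: m => [|m IH].
  by rewrite !expr0 subrr mul0r mul0r subrr ComplexField.Normc.normc0 mul0r expr0n/= !mul0r.
have -> : w ^+ m.+1 - z ^+ m.+1 - m.+1%:R * z ^+ m.+1.-1 * (w - z) =
  w * (w ^+ m - z ^+ m - m%:R * z ^+ m.-1 * (w - z)) +
    m%:R * z ^+ m.-1 * (w - z) ^+ 2.
  case: m {IH} => [|m]; first by rewrite !expr0 !expr1; ring.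
  by rewrite /= !exprS -[m.+2%:R]natr1; ring.
apply: (@le_trans _ _ (rho * (m%:R ^+ 2 * rho ^+ m * normc (w - z) ^+ 2) +
   m%:R * rho ^+ m.+1 * normc (w - z) ^+ 2)).
  apply: le_trans (ler_wpM2r (sqr_ge0 _) (le_normcD _ _)) _.
  rewrite mulrDl; apply: lerD.
    rewrite ComplexField.Normc.normcM -[leLHS]mulrA; apply: ler_pM => //.
    - exact: normc_ge0.
    - by rewrite mulr_ge0 ?normc_ge0 ?sqr_ge0.
  rewrite !ComplexField.Normc.normcM !normcX normc_nat.
  rewrite mulrAC ler_wpM2r ?sqr_ge0//.
  case: (m) => [|k]; first by rewrite !mul0r.
  rewrite /= -mulrA ler_wpM2l// !exprSr expr0 mul1r mulrA.
  rewrite -!mulrA ler_wpM2r ?mulr_ge0 ?(ltW rho0)//.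
  by apply: lerXn2r; rewrite ?nnegrE ?normc_ge0 ?(ltW rho0).
rewrite [rho ^+ m.+1]exprS [leLHS](_ : _ = (m%:R ^+ 2 + m%:R) * (rho * rho ^+ m * normc (w - z) ^+ 2)); last by ring.
rewrite -[leRHS]mulrA ler_wpM2r ?mulr_ge0 ?exprn_ge0 ?normc_ge0 ?(ltW rho0)//.
by rewrite -[m.+1%:R]natr1; have : 0 <= m%:R :> R by []; lra.
Qed.

End ComplexModulus.

Section PowerSeries.
Variables (R : realType) (c : nat -> R[i]) (K : R) (q : nat).
Hypothesis hc : forall m, normc (c m) <= K * m.+1%:R ^+ q.

Let K0 : 0 <= K.
Proof.
by have := hc 0; rewrite expr1n mulr1; apply: le_trans; exact: normc_ge0.
Qed.

Let summable (t : nat -> R[i]) (rho M : R) p : 0 <= rho < 1 -> 0 <= M ->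
  (forall m, normc (t m) <= M * (m.+1%:R ^+ p * rho ^+ m)) ->
  cvgn ((fun N => \sum_(0 <= m < N) t m) : nat -> R[i]^o).
Proof.
move=> rho01 M0 ht; apply: abs_summable_cvg.
apply: (series_le_cvg _ _ ht).
- by move=> m; exact: normc_ge0.
- by move=> m; rewrite !mulr_ge0 ?exprn_ge0//; case/andP: rho01.
- by apply: is_cvg_seriesZ; exact: is_cvg_poly_geometric.
Qed.

Lemma power_series_is_cvg z : disk z -> cvgn (power_series c z).
Proof.
move=> z1; apply: (summable (rho := normc z) (M := K) (p := q)) => //.
  by rewrite normc_ge0.
move=> m; rewrite ComplexField.Normc.normcM normcX mulrA.
by rewrite ler_wpM2r ?exprn_ge0 ?normc_ge0.
Qed.

Lemma power_series_sum_cvg z : disk z ->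
  power_series c z @ \oo --> (power_series_sum c z : R[i]^o).
Proof. exact: power_series_is_cvg. Qed.

(** The derivative is the termwise one: for |w| <= rho, with rho halfway between |z| and 1, the
    second-order remainders of all partial sums are at most M |w-z|^2 with one M, and this survives
    the limit. *)
Lemma power_series_analytic : analytic_on (@disk R) (power_series_sum c).
Proof.
move=> z z1; rewrite /disk/= in z1.
have z0 := normc_ge0 z.
have [rho [rho0 rho1 zrho]] : exists rho : R, [/\ 0 < rho, rho < 1 & normc z < rho].
  by exists ((1 + normc z) / 2); split; lra.
pose D N := \sum_(0 <= m < N) c m * (m%:R * z ^+ m.-1).
have cD : cvgn (D : nat -> R[i]^o).
  apply: (summable (rho := rho) (M := K / rho) (p := q.+1)).
  - by rewrite rho1 ltW.
  - by rewrite divr_ge0// ltW.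
  - move=> m; rewrite !ComplexField.Normc.normcM normc_nat normcX.
    case: m => [|m].
      by rewrite mul0r mulr0 !mulr_ge0 ?invr_ge0 ?exprn_ge0 ?(ltW rho0).
    rewrite [leRHS](_ : _ = (K * m.+2%:R ^+ q) * (m.+2%:R * rho ^+ m)); last first.
      by rewrite !exprS; field; exact: lt0r_neq0.
    apply: ler_pM => //; rewrite ?mulr_ge0 ?normc_ge0 ?exprn_ge0//.
    apply: ler_pM; rewrite ?exprn_ge0 ?ler_nat//.
    by apply: lerXn2r; rewrite ?nnegrE ?(ltW rho0) ?(ltW zrho).
pose L := limn (D : nat -> R[i]^o).
have DL : (D : nat -> R[i]^o) @ \oo --> L := cD.
(* The exponent is q from the coefficients plus 2 from the factor m^2 of the Taylor remainder. *)
pose b := fun m : nat => m.+1%:R ^+ q.+2 * rho ^+ m : R.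
have cb : cvgn (series b) by apply: is_cvg_poly_geometric; rewrite rho1 ltW.
pose M := K * limn (series b) / rho ^+ 2.
have b0 m : 0 <= b m by rewrite mulr_ge0 ?exprn_ge0 ?(ltW rho0).
have M0 : 0 <= M.
  rewrite divr_ge0 ?mulr_ge0 ?exprn_ge0 ?(ltW rho0)//.
  apply: limr_ge => //; apply: nearW => N; exact: sumr_ge0.
have taylor w : normc w <= rho ->
  normc (power_series_sum c w - power_series_sum c z - L * (w - z))
    <= M * normc (w - z) ^+ 2.
  move=> wrho.
  have w1 : disk w by exact: le_lt_trans rho1.
  apply: (@cvg_normc_le _ (fun N => power_series c w N - power_series c z N - D N * (w - z))).
    apply: (@cvgB _ R[i]^o); last first.
      by apply: (@cvgMr_tmp _ _ _ _ (D : nat -> R[i]^o)).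
    by apply: (@cvgB _ R[i]^o); exact: power_series_sum_cvg.
  move=> N0; exists N0 => //.
  rewrite /power_series /D mulr_suml -!sumrB.
  apply: le_trans (normc_sum _ _ _) _.
  apply: (@le_trans _ _ (\sum_(0 <= m < N0) K / rho ^+ 2 * b m * normc (w - z) ^+ 2)).
    apply: ler_sum => m _.
    rewrite [X in normc X](_ : _ = c m * (w ^+ m - z ^+ m - m%:R * z ^+ m.-1 * (w - z))); last by ring.
    rewrite ComplexField.Normc.normcM.
    rewrite [leRHS](_ : _ = K * m.+1%:R ^+ q * (m.+1%:R ^+ 2 * rho ^+ m * normc (w - z) ^+ 2 / rho ^+ 2)); last first.
      by rewrite /b -(addn2 q) exprD; field; exact: lt0r_neq0.
    apply: ler_pM; rewrite ?normc_ge0//.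
    rewrite ler_pdivlMr ?exprn_gt0//.
    apply: le_trans (power_taylor_remainder m rho0 (ltW zrho) wrho) _.
    rewrite !ler_wpM2r ?exprn_ge0 ?normc_ge0 ?(ltW rho0)//.
    by apply: lerXn2r; rewrite ?nnegrE// ler_nat.
  rewrite -mulr_suml -mulr_sumr ler_wpM2r ?sqr_ge0// /M [leRHS]mulrAC.
  rewrite ler_wpM2l ?mulr_ge0 ?invr_ge0 ?exprn_ge0 ?(ltW rho0)//.
  apply: nondecreasing_cvgn_le => //.
  exact: nondecreasing_series.
apply/cvg_ex; exists L; apply/cvg_normcP => e e0.
have del1 : 0 < rho - normc z by rewrite subr_gt0.
have del2 : 0 < e / (M + 1) by rewrite divr_gt0//; lra.
near=> h.
have h0 : h != 0 by near: h; exact: nbhs_dnbhs_neq.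
have hd1 : normc h < rho - normc z.
  rewrite -ltcR; near: h; apply: (@dnbhs0_lt R[i] R[i]^o); by rewrite ltcR.
have hd2 : normc h < e / (M + 1).
  rewrite -ltcR; near: h; apply: (@dnbhs0_lt R[i] R[i]^o); by rewrite ltcR.
have hp : 0 < normc h.
  by rewrite lt_def normc_ge0 andbT; apply: contra h0 => /eqP/ComplexField.Normc.eq0_normc->.
have := @taylor (h + z); rewrite addrK.
have -> : normc (h + z) <= rho.
  by apply: le_trans (le_normcD _ _) _; rewrite -lerBrDr ltW.
move=> /(_ isT) ht.
rewrite /= /shift/= normcB.
rewrite [X in normc X](_ : _ = h^-1 * (power_series_sum c (h + z) - power_series_sum c z - L * h)); last first.
  by rewrite /GRing.scale/= mulr1 [RHS]mulrBr [L * h]mulrC mulKf.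
rewrite ComplexField.Normc.normcM ComplexField.Normc.normcV.
rewrite ler_pdivrMl//; apply: (le_trans ht).
rewrite expr2 mulrA [leRHS]mulrC ler_wpM2r ?(ltW hp)//.
apply: (@le_trans _ _ ((M + 1) * normc h)).
  by rewrite ler_wpM2r ?normc_ge0//; lra.
by rewrite mulrC -ler_pdivlMr ?(ltW hd2)//; lra.
Unshelve. all: by end_near. Qed.

End PowerSeries.

(** * Block polynomials *)

(** Square cells of side 1/L cover the disk, and each cell that meets the closed disk contributes a
    point of both; a corner of the cell could have modulus above 1. The other cells get the point
    0. *)
Lemma disk_net (R : realType) (L : nat) : (0 < L)%N ->
  exists p : 'I_(2 * L) * 'I_(2 * L) -> R[i],
    (forall i, normc (p i) <= 1) /\
    (forall z, disk z -> exists i, normc (z - p i) <= 2 / L%:R).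
Proof.
move=> L0; have L0' : 0 < L%:R :> R by rewrite ltr0n.
pose cell (i : 'I_(2 * L) * 'I_(2 * L)) : set R[i] :=
  [set z | [/\ normc z <= 1,
    i.1%:R <= (complex.Re z + 1) * L%:R < i.1%:R + 1 &
    i.2%:R <= (complex.Im z + 1) * L%:R < i.2%:R + 1]].
exists (fun i => xget 0 (cell i)); split=> [i|z z1].
  case: xgetP => [p _ []//|_]; by rewrite ComplexField.Normc.normc0.
rewrite /disk/= in z1.
have cellx (x : R) : `|x| < 1 -> exists i : 'I_(2 * L),
    i%:R <= (x + 1) * L%:R < i%:R + 1.
  rewrite ltr_norml => /andP[xm1 x1].
  have x0 : 0 <= (x + 1) * L%:R by rewrite mulr_ge0//; lra.
  have xtr := truncn_itv x0.
  have h : (Num.truncn ((x + 1) * L%:R) < 2 * L)%N.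
    rewrite -(ltr_nat R); apply: le_lt_trans (_ : (x + 1) * L%:R < _).
      by case/andP: xtr.
    by rewrite natrM ltr_pM2r//; lra.
  by exists (Ordinal h) => /=; rewrite natr1.
have [i hi] := cellx _ (le_lt_trans (ler_Re_normc z) z1).
have [k hk] := cellx _ (le_lt_trans (ler_Im_normc z) z1).
exists (i, k); case: xgetP => [p _ [p1 /= hpi hpk]|/(_ z)]; last first.
  by case; split => //; exact: ltW.
apply: le_trans (normc_le_ReIm _) _.
have close (x y : R) (m : nat) : m%:R <= (x + 1) * L%:R < m%:R + 1 ->
    m%:R <= (y + 1) * L%:R < m%:R + 1 -> `|x - y| <= 1 / L%:R.
  move=> /andP[h1 h2] /andP[h3 h4]; rewrite ler_pdivlMr// -[X in _ * X](gtr0_norm L0') -normrM.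
  rewrite ler_norml; apply/andP; split; lra.
rewrite [leRHS](_ : _ = 1 / L%:R + 1 / L%:R); last by rewrite -mulrDl.
have -> : complex.Re (z - p) = complex.Re z - complex.Re p by case: (z) (p) => ? ? [].
have -> : complex.Im (z - p) = complex.Im z - complex.Im p by case: (z) (p) => ? ? [].
by apply: lerD; [exact: close hi hpi|exact: close hk hpk].
Qed.

(** For w = x + iy the four real parts are x, -y, -x, y. One-sided bounds on real combinations, as
    exponential moments provide, thus control a modulus at the price of a net four times as
    large. *)
Lemma normc_le_quarter_turns (R : realType) (w : R[i]) (M : R) :
  (forall k : 'I_4, complex.Re ('i ^+ k * w) <= M) -> normc w <= 2 * M.
Proof.
case: w => x y h; apply: le_trans (normc_le_ReIm _) _ => /=.
have h0 := h (@Ordinal 4 0 isT); have h1 := h (@Ordinal 4 1 isT).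
have h2 := h (@Ordinal 4 2 isT); have h3 := h (@Ordinal 4 3 isT).
move: h0 h1 h2 h3.
rewrite !exprS !expr0 !mulr1; simpc => /= h0 h1 h2 h3.
have hx : `|x| <= M by rewrite ler_norml; apply/andP; split; lra.
have hy : `|y| <= M by rewrite ler_norml; apply/andP; split; lra.
lra.
Qed.

Section Blocks.
Variables (R : realType) (n : nat -> nat).
Hypotheses (hn0 : (0 < n 0)%N) (hn : forall k, (n k < n k.+1)%N).

Lemma increasing_gt_id k : (k < n k)%N.
Proof. by elim: k => // k IH; rewrite (leq_ltn_trans IH (hn k)). Qed.

Lemma increasing_block m : (n 0 < m)%N ->
  exists j, ((n j).+1 <= m < (n j.+1).+1)%N.
Proof.
move=> m0; have : (m <= n m)%N by exact: ltnW (increasing_gt_id m).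
elim: {2}m => [|k IH mk]; first by rewrite leqNgt m0.
have [/IH//|kn] := leqP m (n k).
by exists k; rewrite kn ltnS.
Qed.

(** A partial sum through the index n_k consists of whole blocks. The factor z^(n_j + 1) is pulled
    out of each, and one power of |z| is given up to reach the exponent n_j. *)
Lemma power_series_blocks_le (c : nat -> R[i]) (A : nat -> R) (z : R[i]) :
  normc z <= 1 ->
  (forall j, normc (\sum_((n j).+1 <= m < (n j.+1).+1) c m * z ^+ (m - (n j).+1))
    <= A j.+1) ->
  forall k, normc (power_series c z (n k).+1) <=
    \sum_(0 <= m < (n 0).+1) normc (c m)
      + \sum_(1 <= j < k.+1) normc z ^+ n j.-1 * A j.
Proof.
move=> z1 hA; elim=> [|k IH].
  rewrite [X in _ + X]big_geq// addr0; apply: le_trans (normc_sum _ _ _) _.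
  apply: ler_sum => m _; rewrite ComplexField.Normc.normcM normcX.
  by rewrite ler_piMr ?normc_ge0// exprn_ile1// normc_ge0.
rewrite [X in _ + X]big_nat_recr//= addrA.
have nk : ((n k).+1 <= (n k.+1).+1)%N by rewrite ltnS ltnW.
rewrite /power_series (big_cat_nat (leq0n (n k).+1) nk).
apply: le_trans (le_normcD _ _) _; apply: lerD => //.
rewrite (_ : \sum_(_ <= _ < _) _ = z ^+ (n k).+1 *
    \sum_((n k).+1 <= m < (n k.+1).+1) c m * z ^+ (m - (n k).+1)); last first.
  rewrite mulr_sumr; apply: eq_big_nat => m /andP[km _].
  by rewrite mulrCA -exprD subnKC.
rewrite ComplexField.Normc.normcM normcX; apply: ler_pM => //.
- by rewrite exprn_ge0 ?normc_ge0.
- exact: normc_ge0.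
- by rewrite exprS ler_piMl ?exprn_ge0 ?normc_ge0.
Qed.

Lemma block_coef_le (a : nat -> R[i]) j m :
  ((n j).+1 <= m < (n j.+1).+1)%N ->
  normc (a m) <= Num.sqrt (\sum_((n j).+1 <= i < (n j.+1).+1) normc (a i) ^+ 2).
Proof.
move=> hm; rewrite -[leLHS]ger0_norm ?normc_ge0// -sqrtr_sqr ler_sqrt; last first.
  by apply: sumr_ge0 => i _; exact: sqr_ge0.
rewrite (bigD1_seq m) ?mem_index_iota ?iota_uniq//= lerDl.
by apply: sumr_ge0 => i _; exact: sqr_ge0.
Qed.

End Blocks.

Lemma normc_subX_le (R : realType) (z w : R[i]) (m : nat) :
  normc z <= 1 -> normc w <= 1 -> normc (z ^+ m - w ^+ m) <= m%:R * normc (z - w).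
Proof.
move=> z1 w1; elim: m => [|m IH].
  by rewrite !expr0 subrr ComplexField.Normc.normc0 mul0r.
have -> : z ^+ m.+1 - w ^+ m.+1 = z * (z ^+ m - w ^+ m) + w ^+ m * (z - w).
  by rewrite !exprS; ring.
apply: le_trans (le_normcD _ _) _; rewrite -natr1 mulrDl mul1r.
rewrite !ComplexField.Normc.normcM normcX; apply: lerD.
  by apply: le_trans IH; rewrite ler_piMl ?normc_ge0.
by rewrite ler_piMl ?normc_ge0// exprn_ile1// normc_ge0.
Qed.

(** The net point close to z contributes 2M. Moving to z changes each term by at most B (2YN) N
    (2/N^3) = 4YB/N, by m + 2 <= 2N and the Lipschitz constant m - lo <= N, and there are at most N
    terms as lo >= 1. *)
Lemma block_net_bound (R : realType) (a : nat -> R[i]) (X : nat -> R)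
    (lo N : nat) (B Y M : R) (I : Type) (p : I -> R[i]) :
  (0 < lo)%N -> (2 <= N)%N -> 0 <= B -> 0 <= Y ->
  (forall m, (lo <= m < N.+1)%N -> normc (a m) <= B) ->
  (forall m, `|X m| <= Y * m.+2%:R) ->
  (forall i, normc (p i) <= 1) ->
  (forall z, disk z -> exists i, normc (z - p i) <= 2 / (N ^ 3)%:R) ->
  (forall i (k : 'I_4), \sum_(lo <= m < N.+1)
     complex.Re ('i ^+ k * (a m * p i ^+ (m - lo))) * X m <= M) ->
  forall z, disk z ->
  normc (\sum_(lo <= m < N.+1) a m * (X m)%:C * z ^+ (m - lo)) <= 2 * M + 4 * (Y * B).
Proof.
move=> lo0 N2 B0 Y0 aB XY p1 pnet hM z z1; have [i hi] := pnet z z1.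
have N2' : 2 <= N%:R :> R by rewrite ler_nat.
rewrite -[X in normc X](subrK (\sum_(lo <= m < N.+1) a m * (X m)%:C * p i ^+ (m - lo))).
rewrite addrC; apply: le_trans (le_normcD _ _) _; apply: lerD.
  apply: normc_le_quarter_turns => k; apply: le_trans (hM i k).
  rewrite mulr_sumr le_eqVlt; apply/orP; left; apply/eqP.
  rewrite (raddf_sum (@complex.Re R : Rcomplex R -> R)).
  apply: eq_bigr => m _.
  have -> : 'i ^+ k * (a m * (X m)%:C * p i ^+ (m - lo)) =
     'i ^+ k * (a m * p i ^+ (m - lo)) * (X m)%:C by ring.
  by case: ('i ^+ k * _) => u t /=; rewrite mulr0 subr0.
rewrite -sumrB; apply: le_trans (normc_sum _ _ _) _.
apply: (@le_trans _ _ (\sum_(lo <= m < N.+1) 4 * (Y * B) / N%:R)).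
  apply: ler_sum_nat => m hm; rewrite -mulrBr !ComplexField.Normc.normcM normc_real.
  have mN : (m%:R : R) <= N%:R by rewrite ler_nat; case/andP: hm.
  apply: (@le_trans _ _ (B * (Y * (2 * N%:R)) * (N%:R * (2 / (N ^ 3)%:R)))).
    apply: ler_pM; rewrite ?mulr_ge0 ?normc_ge0//.
      apply: ler_pM; rewrite ?normc_ge0 ?aB//.
      apply: le_trans (XY m) _; rewrite ler_wpM2l//.
      by rewrite -addn2 natrD; lra.
    apply: le_trans (normc_subX_le _ (ltW z1) (p1 i)) _.
    apply: ler_pM; rewrite ?normc_ge0//.
    by apply: le_trans mN; rewrite ler_nat leq_subr.
  rewrite le_eqVlt; apply/orP; left; apply/eqP; rewrite natrX; field.
  by rewrite lt0r_neq0//; lra.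
rewrite sumr_const_nat -[leLHS]mulr_natr -[leRHS](@divfK _ N%:R); last first.
  by rewrite lt0r_neq0//; lra.
rewrite ler_wpM2l ?divr_ge0 ?mulr_ge0// ler_nat.
by rewrite leq_subLR -addn1 addnC leq_add2r.
Qed.

(** * Coefficient growth, and membership of the random series in the growth space *)

Section Main.
Variables (R : realType) (v : R -> R) (hv : weight v) (a : nat -> R[i]).
Variables (n : nat -> nat).
Hypotheses (hn0 : (0 < n 0)%N) (hn : forall k, (n k < n k.+1)%N).
Variables (C1 C2 : R).
Hypotheses (hC1 : 0 < C1) (hC2 : 0 < C2).
Hypothesis hg : forall k, weight_g v (n k.+1)%:R <= C1 * weight_g v (n k)%:R.
Let A j := Num.sqrt ((\sum_((n j.-1).+1 <= m < (n j).+1) normc (a m) ^+ 2)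
                  * ln (n j)%:R).
Hypothesis ha : forall k, \sum_(1 <= j < k.+1) A j <= C2 * weight_g v (n k)%:R.

(** For n_j < m <= n_{j+1}, |a_m| sqrt(ln 2) <= A_{j+1} <= C2 g(n_{j+1}). As n_{j+1} may be far
    beyond m, [hg] first returns to g(n_j) <= g(m), which is polynomial in m by the growth bound at
    r = 0. *)
Lemma coef_poly_bound : exists K p, forall m, normc (a m) <= K * m.+1%:R ^+ p.
Proof.
have [p hp] := weight_g_growth hv.
have ln2 : 0 < ln 2 :> R by rewrite ln_gt0//; lra.
pose l2 : R := Num.sqrt (ln 2); have l20 : 0 < l2 by rewrite sqrtr_gt0.
pose H := \sum_(0 <= m < (n 0).+1) normc (a m).
have H0 : 0 <= H by apply: sumr_ge0 => m _; exact: normc_ge0.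
pose K := C1 * C2 * 2 ^+ p / l2.
have K0 : 0 <= K by rewrite divr_ge0 ?mulr_ge0 ?exprn_ge0 ?(ltW hC1) ?(ltW hC2) ?(ltW l20).
exists (H + K), p => m.
have m1 : 1 <= m.+1%:R ^+ p :> R by apply: exprn_ege1; rewrite ler1n.
have [m0|m0] := leqP m (n 0).
  apply: (@le_trans _ _ H).
    rewrite /H (bigD1_seq m) ?mem_index_iota ?iota_uniq//= lerDl.
    by apply: sumr_ge0 => i _; exact: normc_ge0.
  by rewrite mulrDl; apply: ler_wpDr; [rewrite mulr_ge0|rewrite ler_peMr].
apply: (@le_trans _ _ (K * m.+1%:R ^+ p)); last first.
  by rewrite ler_wpM2r ?lerDr// (le_trans ler01 m1).
have [j hj] := increasing_block hn0 hn m0.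
have nj1 : 1 <= (n j)%:R :> R by rewrite ler1n (leq_ltn_trans _ (increasing_gt_id hn0 hn j)).
have nj2 : 2 <= (n j.+1)%:R :> R by rewrite ler_nat; exact: leq_trans (increasing_gt_id hn0 hn j.+1).
have mg : weight_g v (n j)%:R <= 2 ^+ p * m.+1%:R ^+ p.
  have := hp 0 m%:R; rewrite lexx ltr01 subr0 mulr1 (weight0 hv) mulr1 nat1r => hm.
  apply: le_trans (hm isT _); last by rewrite ler1n (leq_trans _ m0).
  by apply: weight_g_mono => //; rewrite ler_nat ltnW//; case/andP: hj.
have S0 : 0 <= \sum_((n j).+1 <= i < (n j.+1).+1) normc (a i) ^+ 2.
  by apply: sumr_ge0 => i _; exact: sqr_ge0.
rewrite /K mulrAC ler_pdivlMr//.
apply: (@le_trans _ _ (A j.+1)).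
  rewrite /A /= sqrtrM//; apply: ler_pM; rewrite ?normc_ge0 ?sqrtr_ge0//.
    exact: block_coef_le.
  by rewrite ler_sqrt ?ln_ge0 ?ler_ln ?posrE//; lra.
apply: (@le_trans _ _ (\sum_(1 <= i < j.+2) A i)).
  by rewrite big_nat_recr//= lerDr; apply: sumr_ge0 => i _; exact: sqrtr_ge0.
apply: le_trans (ha j.+1) _.
rewrite [leRHS](_ : _ = C2 * (C1 * (2 ^+ p * m.+1%:R ^+ p))); last by ring.
rewrite ler_wpM2l ?(ltW hC2)//; apply: le_trans (hg j) _.
by rewrite ler_wpM2l ?(ltW hC1).
Qed.

End Main.

Theorem theorem6p5 (d : measure_display) (T : measurableType d) (R : realType)
    (P : probability T R) (v : R -> R) (hv : weight v)
    (xi : nat -> {RV P >-> R}) (hxi : subnormal_sequence xi)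
    (a : nat -> R[i])
    (n : nat -> nat) (hn0 : (0 < n 0)%N) (hn : forall k, (n k < n k.+1)%N)
    (C1 C2 : R) (hC1 : 0 < C1) (hC2 : 0 < C2)
    (hg : forall k, weight_g v (n k.+1)%:R <= C1 * weight_g v (n k)%:R)
    (ha : forall k,
      \sum_(1 <= j < k.+1)
        Num.sqrt ((\sum_((n j.-1).+1 <= m < (n j).+1) normc (a m) ^+ 2)
                  * ln (n j)%:R)
      <= C2 * weight_g v (n k)%:R) :
  {ae P, forall w,
    let c := fun m => a m * (xi m w)%:C in
    (forall z : R[i], disk z -> cvgn (power_series c z))
    /\ growth_space v (power_series_sum c)}.
Proof.
have [K [q hK]] := coef_poly_bound hv hn0 hn hC1 hC2 hg ha.
have [C C0 hC] := weight_g_sum_bound hv hn0 hn hg hC1 hC2.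
pose S j := \sum_((n j.-1).+1 <= m < (n j).+1) normc (a m) ^+ 2.
pose A j : R := Num.sqrt (S j * ln (n j)%:R).
have S0 j : 0 <= S j by apply: sumr_ge0 => m _; exact: sqr_ge0.
(* From here [j] stands for the block n_j < m <= n_{j+1}, with size parameter n_{j+1}. *)
have n2 j : (j.+2 <= n j.+1)%N by exact: increasing_gt_id.
have N3 j : (0 < n j.+1 ^ 3)%N by rewrite expn_gt0 (leq_trans _ (n2 j)).
pose p j := sval (cid (disk_net R (N3 j))).
have p1 j i : normc (p j i) <= 1 by have [h _] := svalP (cid (disk_net R (N3 j))); exact: h.
have pnet j z : disk z -> exists i, normc (z - p j i) <= 2 / (n j.+1 ^ 3)%:R.
  by have [_ h] := svalP (cid (disk_net R (N3 j))); exact: h.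
pose I j : finType := (('I_(2 * n j.+1 ^ 3) * 'I_(2 * n j.+1 ^ 3)) * 'I_4)%type.
pose b j (i : I j) m :=
  complex.Re ('i ^+ i.2 * (a m * p j i.1 ^+ (m - (n j).+1))).
have hb j i : \sum_(m <- index_iota (n j).+1 (n j.+1).+1) b j i m ^+ 2
    <= Num.sqrt (S j.+1) ^+ 2.
  rewrite sqr_sqrtr// /S; apply: ler_sum => m _.
  rewrite -[leLHS]real_normK ?num_real//.
  apply: lerXn2r; rewrite ?nnegrE ?normc_ge0//.
  apply: le_trans (ler_Re_normc _) _.
  rewrite !ComplexField.Normc.normcM !normcX.
  have -> : normc ('i : R[i]) = 1 by rewrite /= expr0n/= expr1n add0r sqrtr1.
  by rewrite expr1n mul1r ler_piMr ?normc_ge0// exprn_ile1// normc_ge0.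
(* A grid of (2 N^3)^2 points times four quarter turns, for N = n_{j+1}. *)
have hI j : #|I j|%:R <= 16 * (n j.+1)%:R ^+ 6 :> R.
  rewrite !card_prod !card_ord !natrM ?natrX le_eqVlt; apply/orP; left; apply/eqP.
  ring.
have hnet := ae_subnormal_net hxi (fun j => iota_uniq _ _)
  (fun j => sqrtr_ge0 (S j.+1)) n2 hb hI.
(* On this intersection of two almost sure events both random constants are fixed, and the rest is
   deterministic. *)
apply: filterS2 hnet (ae_subnormal_linear_growth hxi) => x [Y1 Y10 hY1] [Y2 Y20 hY2].
pose c m := a m * (xi m x)%:C; rewrite -/c.
have hc m : normc (c m) <= (2 * K * Y2) * m.+1%:R ^+ q.+1.
  rewrite /c ComplexField.Normc.normcM normc_real.
  rewrite [leRHS](_ : _ = (K * m.+1%:R ^+ q) * (Y2 * (2 * m.+1%:R))); last by rewrite exprS; ring.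
  apply: ler_pM; rewrite ?normc_ge0//; apply: le_trans (hY2 m) _.
  by rewrite ler_wpM2l// -[m.+2%:R]natr1 -natr1; have : 0 <= m%:R :> R by []; lra.
split; first by move=> z; exact: power_series_is_cvg hc _.
split; first exact: power_series_analytic hc.
have ln2 : 0 < ln 2 :> R by rewrite ln_gt0//; lra.
pose l2 : R := Num.sqrt (ln 2); have l20 : 0 < l2 by rewrite sqrtr_gt0.
(* The first term bounds the values on the net, the second the oscillation off it, where sqrt(S) <=
   A / sqrt(ln 2). *)
pose Q := 2 * Y1 + 4 * Y2 / l2.
have Q0 : 0 <= Q by rewrite addr_ge0 ?divr_ge0 ?mulr_ge0 ?(ltW l20).
have A0 j : 0 <= A j by exact: sqrtr_ge0.
have hA z : disk z -> forall j,
    normc (\sum_((n j).+1 <= m < (n j.+1).+1) c m * z ^+ (m - (n j).+1)) <= Q * A j.+1.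
  move=> z1 j.
  have ASj : A j.+1 = Num.sqrt (S j.+1) * Num.sqrt (ln (n j.+1)%:R).
    by rewrite /A sqrtrM.
  have Sl : Num.sqrt (S j.+1) <= A j.+1 / l2.
    rewrite ler_pdivlMr// ASj ler_wpM2l ?sqrtr_ge0// ler_sqrt.
      by rewrite ler_ln ?posrE ?ler_nat ?ltr0n ?(leq_trans _ (n2 j)).
    by rewrite ln_ge0// ler1n (leq_trans _ (n2 j)).
  apply: le_trans (_ : 2 * (Y1 * A j.+1) + 4 * (Y2 * Num.sqrt (S j.+1)) <= _).
    apply: (@block_net_bound R a (fun m => xi m x) _ _ _ _ _ _ (p j)) => //.
    - by rewrite (leq_trans _ (n2 j)).
    - by move=> m hm; exact: block_coef_le.
    - exact: pnet.
    - by move=> i k; rewrite ASj; exact: (hY1 j (i, k)).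
  rewrite [leRHS](_ : _ = 2 * (Y1 * A j.+1) + 4 * (Y2 * (A j.+1 / l2))).
    by rewrite lerD2l ler_wpM2l// ler_wpM2l.
  by rewrite /Q; field; exact: lt0r_neq0.
pose H := \sum_(0 <= m < (n 0).+1) normc (c m).
have H0 : 0 <= H by apply: sumr_ge0 => m _; exact: normc_ge0.
(* [H] bounds the terms up to n_0 and is absorbed by v >= 1; [Q * C] bounds the blocks. *)
exists (H + Q * C) => z z1.
have r01 : 0 <= normc z < 1 by rewrite normc_ge0.
apply: (cvg_normc_le (power_series_sum_cvg hc z1)) => M.
exists (n M).+1; first by rewrite ltnW// ltnS ltnW// increasing_gt_id.
apply: le_trans (power_series_blocks_le (A := fun j => Q * A j) hn (ltW z1) (hA z z1) M) _.
rewrite mulrDl; apply: lerD; first by rewrite ler_peMr// (weight_ge1 hv).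
under eq_bigr do rewrite mulrCA.
by rewrite -mulr_sumr -mulrA ler_wpM2l// hC.
Qed.
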